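(* Let $I$ be a compact interval, let $g\in M(I)$ be a Markov interval map with transition matrix $A_g$ and $E_g\neq\emptyset$, let $\mathcal{G}=\mathcal{G}_{A_g}$ be the graph of $A_g$, let $x\in E_g$, and let $V\subseteq\mathcal{G}^0$. Let $X=\{z\in I: g^k(z)=e(x)\text{ for some }k\in\mathbb{N}_0\}$, equipped with the counting measure $\mu$. For each vertex $j\in\mathcal{G}^0$ put $D_j=I_j\cap X$, and for each edge $ij\in\mathcal{G}^1$ put $R_{ij}=g_i^{-1}(I_j\cap X)$ and $f_{ij}=g_i^{-1}|_{I_j\cap X}:D_j\to R_{ij}$. Suppose that $\widehat a_{i\,\iota(x)}=0$ for all $i\in V$. Then $(R_{ij},D_j,f_{ij})$ is a relative branching system for $(\mathcal{G},V)$ on $(X,\mu)$.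
   Context: $\mathbb{N}=\{1,2,\dots\}$, $\mathbb{N}_0=\{0,1,2,\dots\}$. Markov interval maps. Let $\Gamma=\{c_0,c_1^-,c_1^+,\dots,c_{n-1}^-,c_{n-1}^+,c_n\}$ be real numbers with $c_0<c_1^-\le c_1^+<c_2^-\le\dots<c_{n-1}^-\le c_{n-1}^+<c_n$, and put $I_1=[c_0,c_1^-]$, $I_j=[c_{j-1}^+,c_j^-]$ ($1<j<n$), $I_n=[c_{n-1}^+,c_n]$, $E_j=\,]c_j^-,c_j^+[$ ($1\le j\le n-1$, possibly empty), $I=[c_0,c_n]$. A measurable map $g$ is a Markov interval map, $g\in M(I)$, if for such a partition $C=\{I_1,\dots,I_n\}$: (P1) $\mathrm{dom}(g)=\bigcup_j I_j$, $\mathrm{im}(g)=I$, and each branch $g_i:=g|_{I_i}$ is strictly monotone; (P2) for every $i$, $g(I_i)\cap\bigcup_{j}I_j$ is a non-empty union of intervals from $C$. One has $g(\Gamma)\subset\Gamma$ (each branch $g_i$ maps the endpoints of $I_i$ into $\Gamma$). At an endpoint shared by two adjacent $I_i$'s, $g$ may take a different value for each branch; $g^k(z)=w$ means that $w$ is obtained from $z$ by applying $k$ branches successively. The minimal such partition is fixed. Transition matrix: $A_g=(a_{ij})_{i,j=1}^n$, $a_{ij}=1$ if $g(\mathring I_i)\supset\mathring I_j$ and $a_{ij}=0$ otherwise ($\mathring I$ denotes interior). Escape points: $E_g=\bigcup_{k\ge1}g^{-k}\big(\bigcup_{j=1}^{n-1}E_j\big)$. For $x\in E_g$, $\tau(x)$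 is the least natural number with $g^{\tau(x)}(x)\notin\mathrm{dom}(g)$, $e(x)=g^{\tau(x)}(x)$, and $\iota(x)=\hat j$ where $E_j$ is the escape interval containing $e(x)$; here a symbol $\hat j$ is introduced for each $j$ with $E_j\neq\emptyset$. Escape transition matrix: $\widehat A_g=(\widehat a_{uv})$, indexed by $\{1,\dots,n\}\cup\{\hat j:E_j\neq\emptyset\}$, with $\widehat a_{ij}=a_{ij}$ for $i,j\in\{1,\dots,n\}$; $\widehat a_{i\hat k}=1$ if $i\in\{1,\dots,n\}$ and $\mathring I_i\cap g^{-1}(E_k)\neq\emptyset$; and all other entries $0$. Graph: $\mathcal{G}_{A_g}$ has vertices $\{1,\dots,n\}$ and edges $e_{ij}$ (also written $ij$) for each $a_{ij}=1$, with $s(ij)=i$, $r(ij)=j$. Relative branching system for a finite graph $\mathcal{G}$ and $V\subseteq\mathcal{G}^0$ on a measure space $(X,\mu)$: measurable subsets $R_e,D_v\subseteq X$ ($e\in\mathcal{G}^1$, $v\in\mathcal{G}^0$) such that, $\mu$-a.e. (for counting measure: exactly): (1) $R_e\cap R_f=\emptyset$ if $e\neq f$; (2) $D_u\cap D_v=\emptyset$ if $u\neq v$; (3) $R_e\subseteq D_{s(e)}$ for all $e$; (4) $D_v=\bigcup_{e\in s^{-1}(v)}R_e$ if $v\in V$ and $s^{-1}(v)\ne\emptyset$; (5) for each $e$ there are measurable maps $f_e:D_{r(e)}\to R_e$ and $f_e^{-1}:R_e\to D_{r(e)}$ with $f_e\circ f_e^{-1}=\mathrm{Id}_{R_e}$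 and $f_e^{-1}\circ f_e=\mathrm{Id}_{D_{r(e)}}$ $\mu$-a.e., such that $\mu\circ f_e$ is absolutely continuous with respect to $\mu$ on $D_{r(e)}$ and $\mu\circ f_e^{-1}$ is absolutely continuous with respect to $\mu$ on $R_e$. *)

(* Defs.v *)
From HB Require Import structures.
From mathcomp Require Import all_boot all_order all_algebra.
From mathcomp Require Import all_classical all_reals all_analysis.
Set Implicit Arguments.
Unset Strict Implicit.
Unset Printing Implicit Defensive.
Import Order.TTheory GRing.Theory Num.Theory.
Import numFieldNormedType.Exports.
Local Open Scope classical_set_scope.
Local Open Scope ring_scope.

Record digraph := Digraph {
  vertex : finType;
  edge : finType;
  source : edge -> vertex;
  range_vertex : edge -> vertex }.

Definition matrix_graph n (A : 'M[nat]_n) : digraph :=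
  @Digraph 'I_n {p : 'I_n * 'I_n | A p.1 p.2 == 1%N}
    (fun p => (val p).1) (fun p => (val p).2).

(* The measure space is a measurable subset X of an ambient measurable type T,
   with the trace sigma-algebra and the restriction of mu.  A map defined on a
   subset of X is a total function T -> T whose values elsewhere are
   irrelevant.  For the counting measure only the empty set is negligible, so
   that every "almost everywhere" clause then holds everywhere. *)
Section relative_branching_system.
Context d (T : measurableType d) (R : realType) (X : set T)
  (mu : {measure set T -> \bar R}).

(* mu \o f is absolutely continuous with respect to mu on A. *)
Definition image_dominated_on (A : set T) (f : T -> T) :=
  (fun B => mu (f @` (B `&` A))) `<< mu.

Record branching_map (D S : set T) (f : T -> T) : Prop := {
  branching_measurable : measurable_fun D f ;
  branching_maps : f @` D `<=` S ;
  branching_dominated : image_dominated_on D f ;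
  branching_inverse : exists finv : T -> T,
    [/\ measurable_fun S finv /\ finv @` S `<=` D,
        {ae mu, forall z, S z -> f (finv z) = z},
        {ae mu, forall z, D z -> finv (f z) = z}
      & image_dominated_on S finv] }.

Record relative_branching_system (G : digraph) (V : {set vertex G})
    (Rs : edge G -> set T) (Ds : vertex G -> set T) (f : edge G -> T -> T)
    : Prop := {
  rbs_space : measurable X ;
  rbs_edge_set : forall e, measurable (Rs e) /\ Rs e `<=` X ;
  rbs_vertex_set : forall v, measurable (Ds v) /\ Ds v `<=` X ;
  rbs_edge_disj : forall e e', e != e' ->
    {ae mu, forall z, ~ (Rs e `&` Rs e') z} ;
  rbs_vertex_disj : forall u v, u != v ->
    {ae mu, forall z, ~ (Ds u `&` Ds v) z} ;
  rbs_source : forall e, {ae mu, forall z, Rs e z -> Ds (source e) z} ;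
  rbs_relation : forall v, v \in V -> [exists e : edge G, source e == v] ->
    {ae mu, forall z,
      Ds v z <-> (\bigcup_(e in [set e | source e = v]) Rs e) z} ;
  rbs_map : forall e, branching_map (Ds (range_vertex e)) (Rs e) (f e) }.

End relative_branching_system.

(* A map on a finite union of closed intervals [left i, right i] given by one
   branch on each of them; only the values of [branch i] on the i-th interval
   matter.  Indices start at 0: with n = ncut.+1 intervals, [left i] is
   c_0 or c_i^+ and [right i] is c_{i+1}^- or c_n, and the escape interval of
   index j : 'I_ncut lies between the intervals of indices j and j + 1. *)
Record branched_map (R : realType) := BranchedMap {
  ncut : nat;
  left_end : 'I_ncut.+1 -> R;
  right_end : 'I_ncut.+1 -> R;
  branch : 'I_ncut.+1 -> R -> R }.

Section markov_interval_map.
Context (R : realType).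
Implicit Types (a b x y z w : R) (g h : branched_map R).

Definition piece g (i : 'I_(ncut g).+1) : set R :=
  `[left_end i, right_end i]%classic.

Definition escape_interval g (j : 'I_(ncut g)) : set R :=
  `]right_end (widen_ord (leqnSn _) j), left_end (lift ord0 j)[%classic.

Definition endpoints g : set R := range (@left_end R g) `|` range (@right_end R g).

Definition domain g : set R := \bigcup_i @piece g i.

(* g z = w, where g may take one value for each piece containing z. *)
Definition maps_to g z w := exists2 i : 'I_(ncut g).+1, piece i z & branch i z = w.

Fixpoint iter_maps_to g (k : nat) z w :=
  if k is k'.+1 then exists2 y, maps_to g z y & iter_maps_to g k' y w
  else z = w.

Definition strictly_monotone_on (A : set R) (f : R -> R) :=
  {in A &, {homo f : x y / x < y}} \/ {in A &, {homo f : x y /~ x < y}}.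

(* The last clause does not follow from the others: without it, the image of a
   piece could end in the middle of an escape interval. *)
Record markov_partition a b g : Prop := {
  markov_first : left_end (ord0 : 'I_(ncut g).+1) = a ;
  markov_last : right_end (ord_max : 'I_(ncut g).+1) = b ;
  markov_piece : forall i : 'I_(ncut g).+1, left_end i < right_end i ;
  markov_order : forall j : 'I_(ncut g),
    right_end (widen_ord (leqnSn _) j) <= left_end (lift ord0 j) ;
  markov_measurable : forall i : 'I_(ncut g).+1,
    measurable_fun (piece i) (branch i) ;
  markov_monotone : forall i : 'I_(ncut g).+1,
    strictly_monotone_on (piece i) (branch i) ;
  markov_image : \bigcup_i (@branch R g i @` piece i) = `[a, b]%classic ;
  markov_union : forall i : 'I_(ncut g).+1,
    exists J : set 'I_(ncut g).+1, J !=set0 /\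
      (branch i @` piece i) `&` domain g = \bigcup_(j in J) piece j ;
  markov_endpoints : forall i : 'I_(ncut g).+1,
    endpoints g (branch i (left_end i)) /\
    endpoints g (branch i (right_end i)) }.

(* g belongs to M([a, b]) and is presented by a minimal partition: the same map
   has no Markov partition with strictly fewer endpoints among those of g. *)
Definition markov_interval_map a b g :=
  markov_partition a b g /\
  forall h, markov_partition a b h ->
    (forall z w, maps_to h z w <-> maps_to g z w) ->
    endpoints h `<=` endpoints g -> endpoints h = endpoints g.

Definition transition_matrix g : 'M[nat]_((ncut g).+1) :=
  \matrix_(i, j) nat_of_bool `[< (@piece g j)° `<=` @branch R g i @` (@piece g i)° >].

Definition transition_graph g : digraph := matrix_graph (transition_matrix g).

Definition escape_points g : set R :=
  [set x | exists k w, [/\ (0 < k)%N, iter_maps_to g k x w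
                         & (\bigcup_j @escape_interval g j) w]].

Definition escape_time g x : nat :=
  let leaves := [set k | (0 < k)%N /\
                   exists2 w, iter_maps_to g k x w & ~ domain g w] in
  get [set k | leaves k /\ forall m, leaves m -> (k <= m)%N].

Definition escape_value g x : R :=
  get [set w | iter_maps_to g (escape_time g x) x w].

Definition escape_symbol g := {j : 'I_(ncut g) | `[< escape_interval j !=set0 >]}.

Definition escape_index g x (k : escape_symbol g) :=
  escape_interval (val k) (escape_value g x).

Definition escape_matrix g (u v : 'I_(ncut g).+1 + escape_symbol g) : nat :=
  match u, v with
  | inl i, inl j => transition_matrix g i j
  | inl i, inr k =>
      nat_of_bool `[< (piece i)° `&`
          [set z | exists2 w, maps_to g z w & escape_interval (val k) w] !=set0 >]
  | _, _ => 0%N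
  end.

Definition escape_orbit a b g x : set R :=
  [set z | z \in `[a, b] /\ exists k, iter_maps_to g k z (escape_value g x)].

Definition vertex_set a b g x (j : vertex (transition_graph g)) : set R :=
  @piece g j `&` escape_orbit a b g x.

Definition edge_set a b g x (e : edge (transition_graph g)) : set R :=
  @piece g (source e) `&`
  @branch R g (source e) @^-1` vertex_set a b x (range_vertex e).

Definition edge_map g (e : edge (transition_graph g)) : R -> R :=
  'pinv_(fun=> 0) (@piece g (source e)) (@branch R g (source e)).

End markov_interval_map.

(* Main.v *)
Require Import Defs.
From mathcomp Require Import all_boot all_order all_algebra.
From mathcomp Require Import all_classical all_reals all_analysis.
Import Order.TTheory GRing.Theory Num.Theory.
Import numFieldNormedType.Exports.
Local Open Scope classical_set_scope.
Local Open Scope ring_scope.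

(** A point of X reaches e(x), which lies outside the domain of g, whereas
    endpoints of pieces are mapped to endpoints and so never leave the domain.
    Hence X contains no endpoint of a piece ([iter_escape_not_endpoint]), and
    everything else follows from this.

    Two pieces meet in endpoints only ([piece_overlap]), so the sets D_j, and
    with them the sets R_ij, are exactly disjoint.  If g_i maps the interior of
    I_i over the interior of I_j, then D_j, being contained in that interior,
    lies in the image of g_i, and f_ij is a bijection with inverse g_i.

    For the relation at a vertex v in V, let z be in D_v.  As e(x) is not in
    the domain, z is not e(x), and z is interior to I_v, so the orbit of z goes
    on with y = g_v(z).  If y were e(x), then z would witness that the entry of
    the escape matrix at v and iota(x) is 1, which is excluded for v in V.  So
    y is in the domain, and the Markov property supplies a piece I_j that
    contains y and is covered by g_v(I_v): this gives an edge vj with z in R_vj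
    ([transition_of_image]).

    The measure theory is trivial: branches are injective, so the backward
    orbit X is countable ([countable_iter_maps_to]), all its subsets are
    measurable, all maps on them are measurable, and only the empty set is
    negligible for the counting measure ([counting_branching_map]). *)

(** * Countable sets and the counting measure *)

Lemma countable_inj_preimage {T U : Type} (A : set T) (f : T -> U) (B : set U) :
  {in A &, injective f} -> countable B -> countable (A `&` f @^-1` B).
Proof.
move=> finj cB.
have finj' : {in A `&` f @^-1` B &, injective f}.
  by move=> y z; rewrite !inE => -[Ay _] [Az _]; apply: finj; rewrite inE.
rewrite -(eq_countable (inj_card_eq finj')).
by apply: sub_countable cB; apply: subset_card_le => _ [z [_ ?] <-].
Qed.

Section measurable_points.
Context {d : measure_display} {T : measurableType d} {R : realType}.
Hypothesis measurable_point : forall t : T, measurable [set t].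

Lemma countable_measurable_fun {d' : measure_display} {U : measurableType d'}
    (D : set T) (f : T -> U) : countable D -> measurable_fun D f.
Proof.
move=> cD _ Y _; apply: countable_measurable => //.
by apply: sub_countable cD; apply: subset_card_le; exact: subIsetl.
Qed.

(** A set all of whose measurable subsets have counting measure zero contains
    no point, since points are measurable; its image is then empty too. *)
Lemma counting_image_dominated (D : set T) (f : T -> T) :
  image_dominated_on (@counting T R) D f.
Proof.
move=> E nullE B _ BE.
suff -> : B = set0 by rewrite set0I image_set0; exact: measure0.
rewrite -subset0 => z /BE Ez.
have := nullE [set z] (measurable_point z).
have zE : [set z] `<=` E by move=> _ ->.
move=> /(_ zE); rewrite /= /counting asboolT// fset_set1 finmap.cardfs1.
by move=> /eqP; rewrite eqe oner_eq0.
Qed.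

(** With respect to the counting measure, any bijection between countable sets
    is nonsingular in both directions. *)
Lemma counting_branching_map (D S : set T) (f finv : T -> T) :
  countable D -> countable S -> f @` D `<=` S -> finv @` S `<=` D ->
  (forall z, S z -> f (finv z) = z) -> (forall z, D z -> finv (f z) = z) ->
  branching_map (@counting T R) D S f.
Proof.
move=> cD cS fDS finvSD fK finvK; split => //.
- exact: countable_measurable_fun.
- exact: counting_image_dominated.
- exists finv; split.
  + by split => //; exact: countable_measurable_fun.
  + exact: aeW.
  + exact: aeW.
  + exact: counting_image_dominated.
Qed.

End measurable_points.

(** * Pieces and endpoints of a Markov partition *)

Section markov_partition_theory.
Set Implicit Arguments.
Unset Strict Implicit.
Context {R : realType} {a b : R} {g : branched_map R}.
Hypothesis hg : markov_partition a b g.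
Local Notation index := 'I_(ncut g).+1.
Implicit Types (i j : index) (z w : R).

Lemma piece_left_right i z : piece i z <-> left_end i <= z <= right_end i.
Proof. by rewrite /piece /= in_itv /=. Qed.

Lemma piece_ordered i j : (i < j)%N -> right_end i <= left_end j.
Proof.
case: j => m hm /=; elim: m hm => // m IH hm.
have m_lt : (m < ncut g)%N by [].
have := markov_order hg (Ordinal m_lt).
have -> : lift ord0 (Ordinal m_lt) = Ordinal hm by exact: val_inj.
move=> right_le; rewrite ltnS leq_eqVlt => /orP[/eqP im|im].
  by rewrite (_ : i = widen_ord (leqnSn _) (Ordinal m_lt))//; exact: val_inj.
have hm' : (m < (ncut g).+1)%N by exact: ltnW.
apply: le_trans (IH hm' im) _; apply: le_trans (ltW (markov_piece hg _)) _.
by rewrite (_ : Ordinal hm' = widen_ord (leqnSn _) (Ordinal m_lt))//;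
  exact: val_inj.
Qed.

Lemma endpoints_left i : endpoints g (left_end i).
Proof. by left; exists i. Qed.

Lemma endpoints_right i : endpoints g (right_end i).
Proof. by right; exists i. Qed.

Lemma endpoints_domain z : endpoints g z -> domain g z.
Proof.
by case=> -[i _ <-]; exists i => //; apply/piece_left_right;
  rewrite lexx (ltW (markov_piece hg i)).
Qed.

Lemma piece_overlap i j z : i != j -> piece i z -> piece j z -> endpoints g z.
Proof.
wlog ij : i j / (i < j)%N => [wl neq pi pj|_].
  case: (ltngtP i j) => [ij|ji|/val_inj ij]; first exact: (wl i j).
  - by apply: (wl j i) => //; rewrite eq_sym.
  - by rewrite ij eqxx in neq.
move=> /piece_left_right/andP[_ zi] /piece_left_right/andP[jz _].
have -> : z = left_end j.
  by apply/eqP; rewrite eq_le jz (le_trans zi (piece_ordered ij)).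
exact: endpoints_left.
Qed.

Lemma piece_eq i j z : ~ endpoints g z -> piece i z -> piece j z -> i = j.
Proof.
move=> nend pi pj; have [//|ij] := eqVneq i j.
by case: nend; exact: piece_overlap ij pi pj.
Qed.

Lemma endpoint_in_piece i z :
  endpoints g z -> piece i z -> z = left_end i \/ z = right_end i.
Proof.
move=> zend zi.
have [j zj] : exists j, z = left_end j \/ z = right_end j.
  by case: zend => -[j _ <-]; exists j; [left|right].
have := zi => /piece_left_right/andP[iz zi'].
case: (ltngtP i j) => [ij|ji|/val_inj ->//].
- right; apply/eqP; rewrite eq_le zi'; apply: le_trans (piece_ordered ij) _.
  by case: zj => -> //; exact: ltW (markov_piece hg j).
- left; apply/eqP; rewrite eq_le iz andbT; apply: le_trans (piece_ordered ji).
  by case: zj => -> //; exact: ltW (markov_piece hg j).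
Qed.

Lemma piece_interior i z :
  (piece i)° z <-> piece i z /\ ~ endpoints g z.
Proof.
rewrite [in X in X <-> _]/piece interior_itv_bnd /= in_itv /=; split.
- move=> /andP[lz zr].
  have zi : piece i z by apply/piece_left_right; rewrite !ltW.
  split => // /endpoint_in_piece/(_ zi)[] zE.
  + by rewrite zE ltxx in lz.
  + by rewrite zE ltxx in zr.
- move=> [/piece_left_right/andP[lz zr] nend]; rewrite !lt_neqAle lz zr !andbT.
  apply/andP; split; apply/eqP => zE; apply: nend.
  + by rewrite -zE; exact: endpoints_left.
  + by rewrite zE; exact: endpoints_right.
Qed.

Lemma branch_endpoint i z :
  endpoints g z -> piece i z -> endpoints g (branch i z).
Proof.
by move=> zend zi; have [lend rend] := markov_endpoints hg i;
  have [->|->] := endpoint_in_piece zend zi.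
Qed.

Lemma branch_inj i : {in piece i &, injective (@branch R g i)}.
Proof.
move=> y z yi zi yz.
case: (ltgtP y z) => // lt_yz; have [mono|mono] := markov_monotone hg i;
  first [have := mono _ _ yi zi lt_yz | have := mono _ _ zi yi lt_yz];
  by rewrite yz ltxx.
Qed.

Lemma piece_sub i : piece i `<=` `[a, b]%classic.
Proof.
move=> z /piece_left_right/andP[lz zr].
rewrite /= in_itv /= -(markov_first hg) -(markov_last hg); apply/andP; split.
- apply: le_trans lz; have [->//|i0] := eqVneq i ord0.
  apply: le_trans (ltW (markov_piece hg ord0)) _.
  by apply: piece_ordered; rewrite lt0n.
- apply: le_trans zr _; have [->//|imax] := eqVneq i ord_max.
  apply: le_trans (ltW (markov_piece hg ord_max)).
  apply: piece_ordered; rewrite ltn_neqAle -ltnS ltn_ord andbT.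
  by apply: contra imax => /eqP ?; apply/eqP/val_inj.
Qed.

Lemma branch_sub i z : piece i z -> `[a, b]%classic (branch i z).
Proof. by move=> zi; rewrite -(markov_image hg); exists i => //; exists z. Qed.

Lemma escape_interval_domain (j : 'I_(ncut g)) w :
  escape_interval j w -> ~ domain g w.
Proof.
rewrite /escape_interval /= in_itv /= => /andP[jw wj].
move=> [i _ /piece_left_right/andP[iw wi]].
case: (leqP i j) => ij.
- have : right_end i <= right_end (widen_ord (leqnSn (ncut g)) j).
    move: ij; rewrite leq_eqVlt => /orP[/eqP ij|ij].
      by rewrite (_ : i = widen_ord (leqnSn _) j)//; exact: val_inj.
    apply: le_trans (ltW (markov_piece hg _)).
    exact: piece_ordered.
  by move=> /(le_trans wi)/le_lt_trans/(_ jw); rewrite ltxx.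
- have : left_end (lift ord0 j) <= left_end i.
    move: ij; rewrite leq_eqVlt => /orP[/eqP ij|ij].
      by rewrite (_ : lift ord0 j = i)//; exact: val_inj.
    apply: le_trans (ltW (markov_piece hg _)) _.
    exact: piece_ordered.
  by move=> /(lt_le_trans wj)/lt_le_trans/(_ iw); rewrite ltxx.
Qed.

(** * Backward orbits *)

Lemma iter_endpoint k z w :
  endpoints g z -> iter_maps_to g k z w -> endpoints g w.
Proof.
elim: k z => [z zend <-//|k IH z zend [y [i zi <-]]].
by apply: IH; exact: branch_endpoint.
Qed.

(** Endpoints are trapped in the domain, so they never escape. *)
Lemma iter_escape_not_endpoint k z w :
  ~ domain g w -> iter_maps_to g k z w -> ~ endpoints g z.
Proof. by move=> wdom kzw /iter_endpoint/(_ kzw)/endpoints_domain. Qed.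

Lemma countable_iter_maps_to k w : countable [set z | iter_maps_to g k z w].
Proof.
elim: k => [|k IH] /=; first by rewrite (_ : [set z | _] = [set w]);
  [exact: countable1|apply/seteqP; split].
have cU : countable (\bigcup_i (@piece R g i `&`
    @branch R g i @^-1` [set y | iter_maps_to g k y w])).
  apply: bigcup_countable => [|i _];
    first exact/finite_set_countable/finite_finset.
  exact: countable_inj_preimage (@branch_inj i) IH.
apply: sub_countable cU; apply: subset_card_le => z [_ [i zi <-] iz].
by exists i.
Qed.

(** * Edges of the transition graph *)

Lemma transition_matrixP i j :
  transition_matrix g i j = 1%N <->
  (@piece R g j)° `<=` @branch R g i @` (@piece R g i)°.
Proof.
by rewrite mxE; split => [|sub]; [case: asboolP|rewrite asboolT].
Qed.

(** A covered piece has no interior point that is the image of an endpoint, so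
    covering whole pieces and covering interiors by interiors agree. *)
Lemma transition_of_image i z :
  piece i z -> domain g (branch i z) ->
  exists2 j, piece j (branch i z) & transition_matrix g i j = 1%N.
Proof.
move=> zi zdom; have [J [_ imJ]] := markov_union hg i.
have : (@branch R g i @` piece i `&` domain g) (branch i z).
  by split=> //; exists z.
rewrite imJ => -[j Jj zj]; exists j => //; apply/transition_matrixP.
move=> w /piece_interior[wj wend].
have : (\bigcup_(j in J) @piece R g j) w by exists j.
rewrite -imJ => -[[y yi yw] _]; exists y => //; apply/piece_interior.
by split => // /branch_endpoint/(_ yi); rewrite yw.
Qed.

Lemma transition_image i j w :
  transition_matrix g i j = 1%N -> piece j w -> ~ endpoints g w ->
  (@branch R g i @` piece i) w.
Proof.
move=> /transition_matrixP sub wj wend.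
have [z /interior_subset zi <-] : (@branch R g i @` (@piece R g i)°) w.
  by apply: sub; apply/piece_interior.
by exists z.
Qed.

End markov_partition_theory.

Theorem proposition4p2 (R : realType) (a b : R) (g : branched_map R)
    (hg : markov_interval_map a b g)
    (hE : escape_points g !=set0)
    (x : R) (hx : escape_points g x)
    (V : {set vertex (transition_graph g)})
    (iota_x : escape_symbol g) (hiota : escape_index x iota_x)
    (hV : forall i, i \in V -> escape_matrix (inl i) (inr iota_x) = 0%N) :
  relative_branching_system (escape_orbit a b g x) (@counting R R) V
    (edge_set a b x) (vertex_set a b x) (@edge_map R g).
Proof.
have {hE hx} [mg _] := hg.
have e_dom : ~ domain g (escape_value g x).
  exact: (escape_interval_domain mg hiota).
have X_nend z : escape_orbit a b g x z -> ~ endpoints g z.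
  by move=> [_ [k kz]]; exact: (iter_escape_not_endpoint mg e_dom kz).
have cX : countable (escape_orbit a b g x).
  have cU : countable (\bigcup_k
      [set z | iter_maps_to g k z (escape_value g x)]).
    by apply: bigcup_countable => // k _; exact: (countable_iter_maps_to mg).
  by apply: sub_countable cU; apply: subset_card_le => z [_ [k kz]]; exists k.
have cS (A : set R) : A `<=` escape_orbit a b g x -> countable A.
  by move=> AX; apply: sub_countable cX; exact: subset_card_le.
have mS (A : set R) : A `<=` escape_orbit a b g x -> measurable A.
  by move=> /cS; apply: countable_measurable => t; exact: measurable_set1.
have D_X v : @vertex_set R a b g x v `<=` escape_orbit a b g x.
  by move=> z [].
have R_X e : @edge_set R a b g x e `<=` escape_orbit a b g x.
  move=> z [zi [_ [_ [k kz]]]]; split; first exact: (piece_sub mg zi).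
  by exists k.+1; exists (branch (source e) z) => //; exists (source e).
have R_D e : @edge_set R a b g x e `<=` vertex_set a b x (source e).
  by move=> z ze; split; [case: ze|exact: R_X ze].
have D_disj u v z : @vertex_set R a b g x u z ->
    vertex_set a b x v z -> u = v.
  by move=> [zu zX] [zv _]; exact: (piece_eq mg (X_nend _ zX) zu zv).
split => //.
- exact: mS.
- by move=> e; split => //; exact: mS.
- by move=> v; split => //; exact: mS.
- move=> e e' /eqP ee'; apply: aeW => z [ze ze']; apply: ee'.
  (* Both the source and the range of an edge can be read off from a point. *)
  have ss := D_disj _ _ _ (R_D _ _ ze) (R_D _ _ ze').
  case: ze ze' => _ zr [_]; rewrite -ss => zr'.
  have rr := D_disj _ _ _ zr zr'.
  apply/val_inj; move: ss rr => /=.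
  by case: (val e) => ? ?; case: (val e') => ? ? /= -> ->.
- move=> u v /eqP uv; apply: aeW => z [zu zv]; apply: uv.
  exact: D_disj zu zv.
- by move=> e; apply: aeW => z; exact: R_D.
- move=> v vV _; apply: aeW => z; split=> [|[e ev ze]]; last first.
    by rewrite -ev; exact: R_D.
  move=> zD; have [zv zX] := zD; have [_ [[|k] kz]] := zX.
    by case: e_dom; rewrite -kz; exists v.
  have [_ [i zi <-] ky] := kz.
  have iv : i = v by exact: (piece_eq mg (X_nend _ zX) zi zv).
  subst i.
  have y_dom : domain g (branch v z).
    case: k {kz} ky => [yE|k [_ [j yj _] _]]; last by exists j.
    have := hV _ vV; rewrite /escape_matrix asboolT//.
    exists z; split.
      by apply/(piece_interior mg); split => //; exact: X_nend.
    by exists (escape_value g x) => //; exists v.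
  have [j yj vj] := transition_of_image mg zv y_dom.
  have vjE : transition_matrix g (v, j).1 (v, j).2 == 1%N by rewrite /= vj.
  exists (exist _ (v, j) vjE : edge (transition_graph g)) => //.
  split => //; split => //; split; last by exists k.
  exact: (branch_sub mg zv).
- move=> e.
  have eE : transition_matrix g (source e) (range_vertex e) = 1%N.
    by apply/eqP; exact: (valP e).
  have D_im z : vertex_set a b x (range_vertex e) z ->
      (@branch R g (source e) @` piece (source e)) z.
    by move=> [zr zX]; exact: (transition_image mg eE zr (X_nend _ zX)).
  have mapK z : vertex_set a b x (range_vertex e) z ->
      branch (source e) (edge_map e z) = z.
    by move=> /D_im zim; rewrite /edge_map pinvK// inE.
  have branchK z : piece (source e) z -> edge_map e (branch (source e) z) = z.
    by move=> zi; rewrite /edge_map pinvKV ?inE//; exact: branch_inj mg _.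
  apply: (@counting_branching_map _ _ _ _ _ _ _ (@branch R g (source e))) => //.
  + exact: cS _ (D_X _).
  + exact: cS _ (R_X _).
  + move=> _ [z zD <-]; have [y yi yz] := D_im _ zD.
    by rewrite -yz branchK//; split => //=; rewrite yz.
  + by move=> _ [z [_ zD] <-].
  + by move=> z [zi _]; exact: branchK.
Qed.
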